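(* Let $p$ be an odd prime, $q=p^m$, and let $k$ be an integer with $0<k<m$. Let $b,c\in\mathbb F_{q^2}$ with $\mathrm N(b)\ne\mathrm N(c)$, let $\ell(x)=(bx^q+cx)^{p^k}$ and $f(x)=x^{q+1}+\ell(x^2)$. Then $f$ is a planar function on $\mathbb F_{q^2}$ if and only if $p^k\equiv1\pmod4$, $m=2k$, and \[\mathrm N(b-c^q)^{\frac{p^k+1}2}=-(\mathrm N(b)-\mathrm N(c))^{p^k+1}.\]
   Context: $\mathrm N$ denotes the norm from $\mathbb F_{q^2}$ to $\mathbb F_q$, $\mathrm N(u)=u^{q+1}$. A function $f$ on $\mathbb F_{q^n}$ is planar if for every $c\in\mathbb F_{q^n}^*$ the map $x\mapsto f(x+c)-f(x)$ is a permutation of $\mathbb F_{q^n}$. *)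

(* Defs.v *)
From mathcomp Require Import all_boot all_order all_algebra.
Set Implicit Arguments. Unset Strict Implicit. Unset Printing Implicit Defensive.
Import GRing.Theory.
Local Open Scope ring_scope.

(* Norm from F_{q^2} to F_q : N(u) = u^(q+1). *)
Definition normN (F : finFieldType) (q : nat) (u : F) : F := u ^+ q.+1.

Definition planar (F : finFieldType) (f : F -> F) : Prop :=
  forall c : F, c != 0 -> bijective (fun x => f (x + c) - f x).

Definition ellmap (F : finFieldType) (q pk : nat) (b c : F) (x : F) : F :=
  (b * x ^+ q + c * x) ^+ pk.

Definition fmap (F : finFieldType) (q pk : nat) (b c : F) (x : F) : F :=
  x ^+ q.+1 + ellmap q pk b c (x ^+ 2).

(* Main.v *)
(** Write [u^*] for [u^q], [r = p^k], [theta = (c^* - b) / (N c - N b)] and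
    [D = N theta].  Planarity of [f] says that [Tr (x y^* ) + 2 ell (x y)] has no
    nontrivial zero.  With [u = x y], [x y^* = u z] where [z = y^* / y] runs over
    the elements of norm 1 (Hilbert 90), and [ell u = v^r] with [v] in [F_q] means
    [u = v theta].  So [f] is planar iff [v^(r-1)] is never half the trace of an
    element of norm [D], i.e. iff [v^(2(r-1)) - D] is a nonzero square of [F_q]
    for all nonzero [v] in [F_q].  The [v^(r-1)] are the [M]-th roots of unity, where
    [s = p^gcd(k,m)], [q = s^n] and [M = 1 + s + ... + s^(n-1)].

    If [n >= 3], sum [z^(M-h) ((z - D)^((q-1)/2) - 1)] over the squares [z] of the
    roots of unity, [h = (s-1)/2]: looking at base-[s] digits, the only monomial of
    the expansion that survives is [z^h], so the sum cannot vanish.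

    If [n = 2], then [r = s] and the condition reads
    [K^h = X^h mod X^(h+1) - 1], where [K = (X - D) (1 - D^s X)].  As [2 h = -1]
    in [F], differentiating determines the cofactor explicitly; its values
    at [X = D], to first order, force [h] even and [D^(h+1) = -1]. *)

Require Import Defs.
From mathcomp Require Import all_boot all_order all_algebra.
From mathcomp Require Import cyclic finfield ring zify.
Import GRing.Theory.
Local Open Scope ring_scope.

(** * Reduction to translated powers in the subfield *)

(** Lets [ring] use a known equation: once the two differences agree identically, the goal follows
    from that equation. *)
Lemma eq_of_subr_eq (V : zmodType) (x y u v : V) :
  u = v -> x - y = u - v -> x = y.
Proof. by move=> -> /eqP; rewrite subrr subr_eq0 => /eqP. Qed.

Lemma finField_prim_root (F : finFieldType) :
  exists g : F, #|F|.-1.-primitive_root g.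
Proof.
have card_gt1 := finNzRing_gt1 F.
have : has #|F|.-1.-primitive_root [seq x <- enum F | x != 0].
  apply: has_prim_root; first by rewrite -subn1 subn_gt0.
  - apply/allP => x; rewrite mem_filter => /andP[x0 _].
    apply/unity_rootP/(mulfI x0).
    by rewrite -exprS prednK ?expf_card ?mulr1 // ltnW.
  - by rewrite filter_uniq // enum_uniq.
  by rewrite -(cardC1 (0 : F)) cardE enumT.
by case/hasP => g _ gP; exists g.
Qed.

(** As [q] and [r] are powers of the characteristic, [f] is a quadratic form over the prime field:
    [f (x + a) - f x] is [f a] plus the polar form [B x a], additive in [x]. On a finite set,
    bijectivity thus amounts to a trivial kernel. *)
Lemma planar_fmapP (F : finFieldType) (q r : nat) (b c : F) :
    [pchar F].-nat q -> [pchar F].-nat r ->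
  planar (fmap q r b c) <->
  (forall x a, x != 0 -> a != 0 ->
     x * a ^+ q + x ^+ q * a + 2%:R * ellmap q r b c (x * a) != 0).
Proof.
move=> char_q char_r.
have ellD : {morph ellmap q r b c : x y / x + y}.
  move=> x y; rewrite /ellmap (exprDn_pchar x y char_q) -(exprDn_pchar _ _ char_r).
  by congr (_ ^+ _); ring.
set B := fun x a => x * a ^+ q + x ^+ q * a + 2%:R * ellmap q r b c (x * a).
have BD x y a : B (x + y) a = B x a + B y a.
  by rewrite /B exprDn_pchar // [(_ + _) * a]mulrDl ellD; ring.
have fB x a : fmap q r b c (x + a) - fmap q r b c x = B x a + fmap q r b c a.
  rewrite /fmap /B !exprS exprDn_pchar // !expr0 !mulr1.
  have -> : (x + a) * (x + a) = x * x + (x * a + x * a) + a * a by ring.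
  by rewrite !ellD; ring.
have B0 a : B 0 a = 0 by apply/(addrI (B 0 a)); rewrite -BD !addr0.
split=> [plan x a x0 a0 | nondeg a a0].
  apply: contraNneq x0 => Bxa; rewrite -/(B x a) in Bxa.
  by apply/eqP/(bij_inj (plan a a0)); rewrite !fB Bxa B0.
apply: injF_bij => x y; rewrite !fB => /addIr Bxy.
apply/eqP; rewrite -subr_eq0; apply: contraT => xy0.
have /eqP[] := nondeg _ _ xy0 a0; rewrite -/(B (x - y) a).
by apply: (addIr (B y a)); rewrite -BD subrK add0r.
Qed.

(** The multiplicative group is cyclic of order [(q - 1)(q + 1)], so an exponent killed by [q + 1]
    is a multiple of [q - 1]. *)
Lemma Hilbert90 (F : finFieldType) (q : nat) (z : F) :
    #|F| = (q ^ 2)%N -> (1 < q)%N -> z ^+ q.+1 = 1 ->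
  exists2 y, y != 0 & z = y ^+ q.-1.
Proof.
move=> cardF q_gt1 z1; have [g gP] := finField_prim_root F.
have cardE : #|F|.-1 = (q.-1 * q.+1)%N by rewrite cardF; lia.
have z0 : z != 0 by apply: contra_eq_neq z1 => ->; rewrite expr0n /= eq_sym oner_neq0.
have [|[i /= _] zE] := prim_rootP gP (x := z); first by rewrite cardE mulnC exprM z1 expr1n.
have : (#|F|.-1 %| i * q.+1)%N by rewrite (prim_order_dvd gP) exprM -zE z1.
rewrite cardE dvdn_pmul2r // => /dvdnP[j iE].
exists (g ^+ j); last by rewrite -exprM -iE.
by rewrite expf_neq0 // (prim_root_eq0 gP) cardE; nia.
Qed.

(** A nonzero element of the subfield is [g ^+ i] with [q + 1] dividing [i], and [q + 1] is even. *)
Lemma sqrt_of_subfield (F : finFieldType) (q : nat) (y : F) :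
    #|F| = (q ^ 2)%N -> (1 < q)%N -> odd q -> y ^+ q = y -> exists d, d ^+ 2 = y.
Proof.
move=> cardF q_gt1 odd_q yq; have [g gP] := finField_prim_root F.
have [-> | y0] := eqVneq y 0; first by exists 0; rewrite expr0n.
have cardE : #|F|.-1 = (q.-1 * q.+1)%N by rewrite cardF; lia.
have y1 : y ^+ q.-1 = 1 by apply: (mulfI y0); rewrite -exprS prednK ?mulr1 // ltnW.
have [|[i /= _] yE] := prim_rootP gP (x := y); first by rewrite cardE exprM y1 expr1n.
have : (#|F|.-1 %| i * q.-1)%N by rewrite (prim_order_dvd gP) exprM -yE y1.
rewrite cardE mulnC dvdn_pmul2r; last by lia.
case/dvdnP => j iE; exists (g ^+ (j * q.+1)./2).
rewrite -exprM muln2 halfK oddM /= odd_q andbF subn0 -iE -yE //.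
Qed.

(** The power [q./2] is Euler's criterion in the subfield of order [q]. An element of norm [D] and
    trace [2 Y] is a root of [T^2 - 2 Y T + D] whose conjugate is the other root; such a [w] exists
    exactly when the reduced discriminant [Y^2 - D] is zero or a nonsquare of the subfield. *)
Lemma planar_fmap_powersP (F : finFieldType) (q r : nat) (b c : F) :
    [pchar F].-nat q -> [pchar F].-nat r -> #|F| = (q ^ 2)%N -> odd q ->
    (1 < q)%N -> normN q b != normN q c ->
  planar (fmap q r b c) <->
  (forall v, v != 0 -> v ^+ q = v ->
     ((v ^+ r.-1) ^+ 2 - normN q (b - c ^+ q) / (normN q b - normN q c) ^+ 2)
        ^+ q./2 = 1).
Proof.
move=> char_q char_r cardF odd_q q_gt1 Nbc.
have r_gt0 : (0 < r)%N by case/andP: char_r.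
have qq (u : F) : (u ^+ q) ^+ q = u by rewrite -exprM mulnn -cardF expf_card.
have qD (u v : F) : (u + v) ^+ q = u ^+ q + v ^+ q by apply: exprDn_pchar.
have qN (u : F) : (- u) ^+ q = - u ^+ q by apply: exprNn_pchar.
have q1E : q.-1 = (2 * q./2)%N by rewrite -[in LHS](odd_double_half q) odd_q mul2n.
have two0 : 2%:R != 0 :> F.
  have : q%:R == 0 :> F.
    by apply: contraLR q_gt1; rewrite natf_neq0_pchar -leqNgt => /(pnat_1 char_q) ->.
  apply: contraTneq => two0; rewrite -(odd_double_half q) odd_q -mul2n natrD natrM two0.
  by rewrite mul0r addr0 oner_neq0.
have two_q : 2%:R ^+ q = 2%:R :> F by rewrite -[2%:R]/(1 + 1) qD !expr1n.
set n := normN q c - normN q b.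
have n0 : n != 0 by rewrite subr_eq0 eq_sym.
have nq : n ^+ q = n by rewrite /n /normN qD qN !exprS !exprMn !qq; ring.
have nE : n = c * c ^+ q - b * b ^+ q by rewrite /n /normN !exprS.
set th := (c ^+ q - b) / n.
have thq : th ^+ q = (c - b ^+ q) / n by rewrite /th exprMn qD qN qq exprVn nq.
have th0 : th != 0.
  rewrite mulf_neq0 ?invr_eq0 // subr_eq0; apply: contra_neq n0 => e.
  by rewrite nE -e qq mulrC subrr.
have -> : normN q (b - c ^+ q) / (normN q b - normN q c) ^+ 2 = th * th ^+ q.
  rewrite thq /th -[normN q b - _]opprB -/n sqrrN /normN exprS qD qN qq expr2 invfM; ring.
have [D DE] : exists D, th * th ^+ q = D by exists (th * th ^+ q).
rewrite DE.
have D0 : D != 0 by rewrite -DE mulf_neq0 // expf_neq0.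
have Dq : D ^+ q = D by rewrite -DE exprMn qq mulrC.
(* [th] solves [b * th ^+ q + c * th = 1]. *)
have ell_th v : v ^+ q = v -> ellmap q r b c (v * th) = v ^+ r.
  move=> vq; rewrite /ellmap exprMn vq; congr (_ ^+ _).
  by rewrite thq /th nE; field; rewrite -nE.
have vr v : v * v ^+ r.-1 = v ^+ r :> F by rewrite -exprS prednK.
(* Conversely, [v = b u^q + c u] and its conjugate form a linear system in [u] and [u^q] with
   determinant [n] up to sign. *)
have thE v : v ^+ q = v -> forall u, v = b * u ^+ q + c * u -> u = v * th.
  move=> vq u vE; rewrite /th mulrA; apply: (mulIf n0); rewrite divfK //.
  by rewrite nE [v * _]mulrBr -{2}vq vE qD !exprMn qq; ring.
clearbody th; split.
- move/(planar_fmapP _ _ _ b c char_q char_r) => nondeg v v0 vq.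
  set Y := v ^+ r.-1; have Yq : Y ^+ q = Y by rewrite /Y exprAC vq.
  apply/eqP; apply: contraT => Delta1.
  have [d dE] : exists d, d ^+ 2 = Y ^+ 2 - D.
    by apply: (sqrt_of_subfield _ q) => //; rewrite qD qN Dq exprAC Yq.
  (* [d ^+ 2] is fixed by conjugation, so [d ^+ q] is [d] or [- d]; a nonzero fixed [d] would
     satisfy Euler's criterion, against [Delta1]. *)
  have dq : d ^+ q = - d.
    have [d_0|d0] := eqVneq d 0; first by rewrite d_0 expr0n gtn_eqF ?oppr0 // ltnW.
    have : (d ^+ q) ^+ 2 == d ^+ 2 by rewrite exprAC dE qD qN Dq exprAC Yq.
    rewrite eqf_sqr => /orP[]/eqP // e; case/eqP: Delta1.
    by rewrite -dE -exprM -q1E; apply: (mulfI d0); rewrite -exprS prednK ?mulr1 // ltnW.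
  set w := Y + d; have wq : w ^+ q = Y - d by rewrite qD Yq dq.
  have wD : w * w ^+ q = D by rewrite wq -[D](subKr (Y ^+ 2)) -dE /w; ring.
  (* [w] and [th] both have norm [D], so [- (w / th)] has norm 1. The resulting [y], paired with
     [v * th / y], is a zero of the polar form. *)
  have [y y0 zE] : exists2 y, y != 0 & - (w / th) = y ^+ q.-1.
    apply: (Hilbert90 _ q) => //.
    by rewrite exprS qN mulrNN exprMn exprVn mulrACA wD -invfM DE divff.
  have yq : y ^+ q = - (w / th) * y by rewrite zE mulrC -exprS prednK // ltnW.
  have w0 : w != 0 by apply: contraNneq D0 => w_0; rewrite -wD w_0 mul0r.
  have /eqP[] := nondeg (v * th / y) y (mulf_neq0 (mulf_neq0 v0 th0) (invr_neq0 y0)) y0.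
  rewrite divfK // ell_th // -vr !exprMn exprVn vq yq -/Y.
  have -> : th ^+ q = w * (2%:R * Y - w) / th.
    apply: (mulfI th0); rewrite DE -wD wq /w; field; exact: th0.
  by clearbody w; field; rewrite th0 y0 oppr_eq0.
- move=> hyp; apply/(planar_fmapP _ _ _ b c char_q char_r) => x y x0 y0.
  apply/eqP => Bxy.
  set u := x * y in Bxy; set v := b * u ^+ q + c * u.
  have u0 : u != 0 by rewrite mulf_neq0.
  have vr2 : v ^+ r = - (x * y ^+ q + x ^+ q * y) / 2%:R.
    apply: (mulfI two0); rewrite mulrCA divff // mulr1.
    by apply/eqP; rewrite -addr_eq0 addrC Bxy.
  have vq : v ^+ q = v.
    apply/eqP; rewrite -subr_eq0.
    (* [v ^+ r] is minus half a trace, hence fixed by conjugation; the [r]-th power map is additive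
       with trivial kernel. *)
    have : (v ^+ q - v) ^+ r = 0.
      rewrite exprDn_pchar // exprNn_pchar // -exprM mulnC exprM vr2.
      by rewrite mulNr qN exprMn exprVn two_q qD !exprMn !qq; field.
    by move/eqP; rewrite expf_eq0 r_gt0.
  have uE : u = v * th by apply: thE.
  have v0 : v != 0 by apply: contraNneq u0 => v0; rewrite uE v0 mul0r.
  set Y := v ^+ r.-1.
  have Yq : Y ^+ q = Y by rewrite /Y exprAC vq.
  set w := - (th * y ^+ q / y).
  have wD : w * w ^+ q = D.
    by rewrite /w qN !exprMn exprVn qq -DE; field; rewrite y0 expf_neq0.
  have wY : w + w ^+ q = 2%:R * Y.
    apply: (mulfI v0); rewrite mulrCA vr vr2 mulrCA divff // mulr1.
    have uqE : v * th ^+ q = x ^+ q * y ^+ q by rewrite -{1}vq -exprMn -uE exprMn.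
    rewrite /w qN !exprMn exprVn qq mulrDr !mulrN !mulrA -uE uqE /u; field.
    by rewrite y0 expf_neq0.
  clearbody w.
  have wq : w ^+ q = 2%:R * Y - w by rewrite -wY addrC addKr.
  have Delta : (w - Y) ^+ 2 = Y ^+ 2 - D.
    by rewrite -wD wq; ring.
  (* [w - Y] is a square root of [Y^2 - D]. The criterion makes it nonzero and fixed by conjugation,
     while [wY] makes conjugation negate it. *)
  have := hyp v v0 vq; rewrite -/Y -Delta -exprM -q1E => dq.
  have d0 : w - Y != 0.
    apply: contra_eq_neq dq => ->; rewrite expr0n.
    by case: (q) q_gt1 => [|[|?]] // _; rewrite eq_sym oner_neq0.
  have : (w - Y) ^+ q = w - Y by rewrite -[in LHS](prednK (ltnW q_gt1)) exprS dq mulr1.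
  rewrite qD qN Yq wq => e.
  case/eqP: d0; apply: (mulfI two0); rewrite mulr0.
  refine (@eq_of_subr_eq F _ _ _ _ (esym e) _); ring.
Qed.

(** * Three or more digits *)

(** Frobenius turns [('X - D)^s] into ['X^s - D^s], so the power is a factor of degree [h < s] times
    a polynomial in ['X^s]. Each exponent splits in only one way, without carries. *)
Lemma coef_exp_XsubC_digit (F : fieldType) (s h N j i : nat) (D : F) :
    [pchar F].-nat s -> (h < s)%N -> (j < s)%N ->
  (('X - D%:P) ^+ (h + s * N))`_(j + s * i) =
  (('X - D%:P) ^+ h)`_j * (('X - (D ^+ s)%:P) ^+ N)`_i.
Proof.
move=> char_s h_s j_s; have s_gt0 : (0 < s)%N by apply: leq_ltn_trans h_s.
have char_ps : [pchar {poly F}].-nat s by rewrite (eq_pnat _ (pchar_poly F)).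
have Xs : ('X - D%:P) ^+ s = ('X - (D ^+ s)%:P) \Po 'X^s.
  by rewrite comp_polyB comp_polyX comp_polyC exprDn_pchar // exprNn_pchar // polyC_exp.
rewrite exprD exprM Xs -rmorphXn /= coefM.
have j_ji : (j < (j + s * i).+1)%N by rewrite ltnS leq_addr.
rewrite (bigD1 (Ordinal j_ji)) //= addKn coef_comp_poly_Xn // dvdn_mulr // mulKn //.
rewrite big1 ?addr0 // => k k_j.
have [s_k|k_s] := leqP s k.
  by rewrite nth_default ?mul0r // size_exp_XsubC (leq_trans h_s).
rewrite coef_comp_poly_Xn //; case: ifP => [s_dvd|_]; last by rewrite mulr0.
case/eqP: k_j; apply: val_inj => /=.
have k_le : (k <= j + s * i)%N by rewrite -ltnS.
have : (k == j + s * i %[mod s])%N by rewrite eq_sym eqn_mod_dvd.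
have -> : ((j + s * i) %% s = j)%N by rewrite addnC mulnC modnMDl modn_small.
by rewrite modn_small // => /eqP.
Qed.

Lemma sum_prim_root (F : fieldType) (M : nat) (g : F) (j : nat) :
  M.-primitive_root g ->
  \sum_(k < M) (g ^+ j) ^+ k = if (M %| j)%N then M%:R else 0.
Proof.
move=> gP; rewrite (prim_order_dvd gP); case: eqP => [->|/eqP gj].
  by rewrite (eq_bigr (fun=> 1)) ?sumr_const ?card_ord // => k _; rewrite expr1n.
apply/eqP; have /eqP := subrX1 (g ^+ j) M.
by rewrite exprAC (prim_expr_order gP) expr1n subrr eq_sym mulf_eq0 subr_eq0 (negPf gj).
Qed.

(** The base-[s] digits of [h * M] all equal [h]; so a digit larger than [h] makes
    the coefficient of ['X^i] in [('X - D%:P) ^+ (h * M)] vanish. *)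
Lemma digits_of_congruent (s h M M4 i : nat) :
    s = h.*2.+1 -> M = (1 + s + s * s * (1 + s * M4))%N -> (i <= h * M)%N ->
    (M %| 2 * (i + (M - h)))%N -> i != h ->
  (exists a b, [/\ (h < a)%N, (a < s)%N & i = a + s * b]%N) \/
  (exists a b c d, [/\ (h < c)%N, (a < s)%N, (b < s)%N, (c < s)%N &
     i = a + s * (b + s * (c + s * d))]%N).
Proof.
move=> sE ME i_le /dvdnP[c' e] i_h.
have h_M : (h < M)%N by nia.
have c_ge2 : (1 < c')%N.
  rewrite ltnNge; apply/negP => c1.
  have : (c' * M <= M)%N by rewrite -[X in (_ <= X)%N]mul1n leq_mul2r c1 orbT.
  lia.
(* The hypothesis says [2 i = 2 h] modulo [M]; the bound [i <= h * M] then forces the multiple [l]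
   below [2 h]. *)
have {e} e : (2 * i = (c' - 2) * M + h.*2)%N by rewrite mulnBl; nia.
have {c_ge2 c'} [l {}e] : exists l, (2 * i = l * M + h.*2)%N by exists (c' - 2)%N.
have l_s : (l < h.*2)%N.
  rewrite ltnNge; apply/negP => l_ge.
  have : (h.*2 * M <= l * M)%N by rewrite leq_mul2r l_ge orbT.
  have h_gt0 : (0 < h)%N by case: (posnP h) i_le i_h => // -> ; rewrite leqn0 => ->.
  by rewrite -doubleMl; lia.
have l_gt0 : (0 < l)%N by case: l e l_s => // e; move/eqP: i_h; lia.
(* If [l = 2 u], then [i = u M + h] has lowest digit [u + h > h]. If [l = 2 u + 1], then [M] is
   even, [i = u M + M / 2 + h], and the digit exceeding [h] is the third, [u + h + 1]. *)
have [odd_l|even_l] := boolP (odd l); last first.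
  left; have lE : l = (2 * l./2)%N by rewrite -[LHS]odd_double_half (negPf even_l) mul2n.
  move: (l./2) lE => u lE; subst l.
  exists (u + h)%N, (u * (1 + s * (1 + s * M4)))%N; split; [lia | lia |].
  by subst M; lia.
right.
have oM4 : odd M4.
  have : ~~ odd (l * M) by have := congr1 odd e; rewrite !mul2n oddD !odd_double addbF => <-.
  by rewrite ME sE !oddM odd_l /= !oddD !oddM !oddD /= odd_double oddM /= odd_double /=; case: (odd M4).
have M4E : M4 = (2 * M4./2).+1 by rewrite -[LHS]odd_double_half oM4 mul2n.
have lE : l = (2 * l./2).+1 by rewrite -[LHS]odd_double_half odd_l mul2n.
move: (l./2) lE (M4./2) M4E => u lE v M4E; subst l.
exists u, u.+1, (u + h.+1)%N, (u * M4 + v)%N.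
by split; try lia; subst M M4; lia.
Qed.

(** [M4] gathers the digits of [M] beyond the third. A weighted sum over the squares of the roots of
    unity is evaluated twice: through the expansion of [P] it is [P_h * M], nonzero; through the
    hypothesis it is a vanishing sum of roots of unity. *)
Lemma three_digits_contra (F : fieldType) (s h M M4 : nat) (g D : F) :
    [pchar F].-nat s -> (0 < h)%N -> s = h.*2.+1 ->
    M = (1 + s + s * s * (1 + s * M4))%N -> M.-primitive_root g -> D != 0 ->
  ~ (forall k, ((g ^+ k) ^+ 2 - D) ^+ (h * M) = 1).
Proof.
move=> char_s h_gt0 sE ME gP D0 hyp.
have h_s : (h < s)%N by lia.
have h_M : (h < M)%N by lia.
set P : {poly F} := ('X - D%:P) ^+ (h * M).
have PE : P = ('X - D%:P) ^+ (h + s * (h + s * (h + s * (h * M4)))).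
  by congr (_ ^+ _); rewrite ME; lia.
have sz C a : (h < a)%N -> (('X - C%:P) ^+ h : {poly F})`_a = 0.
  by move=> ?; rewrite nth_default // size_exp_XsubC.
(* The digits of the index are [h, 0, 0, ...]: the lowest contributes a leading coefficient, the
   rest a constant term. *)
have P_h : P`_h != 0.
  rewrite PE -[X in _`_X]addn0 -[X in _`_(_ + X)](muln0 s) coef_exp_XsubC_digit //.
  rewrite -[X in _`_X * _]/(h.+1.-1) -[in X in _`_X * _](size_exp_XsubC h D).
  rewrite -lead_coefE (monicP (monic_exp _ (monicXsubC _))) mul1r.
  by rewrite -horner_coef0 horner_exp !hornerE /= expf_neq0 // oppr_eq0 expf_neq0.
have P_0 i : (i <= h * M)%N -> (M %| 2 * (i + (M - h)))%N -> i != h -> P`_i = 0.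
  move=> i_le Mi i_h; rewrite PE.
  have [[a [b [ha sa ->]]]|[a [b [c [d [hc sa sb sc ->]]]]]] :=
    digits_of_congruent _ _ _ _ _ sE ME i_le Mi i_h.
    by rewrite coef_exp_XsubC_digit // sz // mul0r.
  by rewrite !coef_exp_XsubC_digit // (sz _ c) // mul0r !mulr0.
have : \sum_(k < M) (g ^+ (2 * (M - h))) ^+ k * P.[(g ^+ k) ^+ 2] = P`_h * M%:R.
  transitivity (\sum_(i < (h * M).+1) P`_i * \sum_(k < M) (g ^+ (2 * (i + (M - h)))) ^+ k).
    under [RHS]eq_bigr do rewrite mulr_sumr.
    rewrite exchange_big /=; apply: eq_bigr => k _.
    rewrite horner_coef size_exp_XsubC mulr_sumr; apply: eq_bigr => i _.
    rewrite mulrCA -!exprM -exprD; congr (_ * _ ^+ _); lia.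
  have h_hM : (h < (h * M).+1)%N by nia.
  rewrite (bigD1 (Ordinal h_hM)) //= -[RHS]addr0; congr (_ + _).
    by rewrite sum_prim_root // subnKC 1?ltnW // dvdn_mull.
  rewrite big1 // => i i_h.
  rewrite sum_prim_root //; case: ifP => [Mi|_]; last by rewrite mulr0.
  by rewrite P_0 ?mul0r // -ltnS.
rewrite (eq_bigr (fun k : 'I_M => (g ^+ (2 * (M - h))) ^+ k)) => [|k _].
  rewrite sum_prim_root //; case: ifP => [|_ /esym/eqP]; last first.
    by rewrite mulf_eq0 (negPf P_h) (negPf (prim_root_natf_neq0 gP)).
  (* Since [0 < M - 2 h < M], the exponent is not a multiple of [M]. *)
  have -> : (2 * (M - h) = M + (M - h.*2))%N by lia.
  rewrite dvdn_addr // gtnNdvd //; lia.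
by rewrite horner_exp !hornerE hyp mulr1.
Qed.

(** * Two digits *)

Lemma sub_Xn1_dvdp (F : fieldType) (n : nat) (g : F) (P : {poly F}) :
  n.-primitive_root g -> (forall z, z ^+ n = 1 -> P.[z] = 0) ->
  'X^n - 1 %| P.
Proof.
move=> gP P0; rewrite -(factor_Xn_sub_1 gP).
rewrite -(big_map (fun i => g ^+ i) xpredT (fun x => 'X - x%:P)).
apply: uniq_roots_dvdp.
  apply/allP=> _ /mapP[i _ ->]; apply/rootP/P0.
  by rewrite exprAC (prim_expr_order gP) expr1n.
rewrite uniq_rootsE map_inj_in_uniq ?iota_uniq // => i j.
rewrite !mem_index_iota /= => i_n j_n /eqP.
by rewrite (eq_prim_root_expr gP) !modn_small // => /eqP.
Qed.

(** Because [2 h = -1] in [F], [K ^+ h] behaves like an inverse square root of [K]. Its differential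
    equation, reduced modulo ['X^(h.+1) - 1], determines [R * K] up to a linear quotient, which
    values at 0 pin down. *)
Lemma cubic_remainder (F : fieldType) (h : nat) (g D E : F) :
    (0 < h)%N -> h.*2.+1%:R = 0 :> F -> h.+1.-primitive_root g -> D != 0 ->
    (forall z, z ^+ h.+1 = 1 -> ((z - D) * (1 - E * z)) ^+ h = z ^+ h) ->
  let K : {poly F} := ('X - D%:P) * (1 - E%:P * 'X) in
  let a : {poly F} := ((- D) ^+ h.+1)%:P in
  exists R : {poly F},
    K ^+ h = 'X^h + ('X^(h.+1) - 1) * R /\
    R * K = a * 'X^(h.+1) - D%:P * 'X^h + E%:P * 'X - a.
Proof.
move=> h_gt0 char gP D0 hyp K a.
have sK : (size K <= 3)%N.
  have sEX : (size (E%:P * 'X)%R <= 2)%N.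
    by rewrite (leq_trans (size_polyMleq _ _)) // size_polyX addn2 size_polyC; case: (E != 0).
  have sE : (size (1 - E%:P * 'X)%R <= 2)%N.
    by rewrite (leq_trans (size_polyD _ _)) // size_polyN size_poly1 geq_max.
  by apply: leq_trans (size_polyMleq _ _) _; rewrite size_XsubC.
set T : {poly F} := 'X^(h.+1) - 1.
have sT : size T = h.+2 by rewrite /T size_XnsubC.
have T0 : T != 0 by rewrite -size_poly_eq0 sT.
have /dvdpP[R defR] : T %| K ^+ h - 'X^h.
  apply: sub_Xn1_dvdp gP _ => z zn.
  by rewrite /K !hornerE /= hyp // subrr.
exists R.
have defP : K ^+ h = 'X^h + T * R by rewrite [T * R]mulrC -defR addrC subrK.
split=> //.
have sR : (size R <= h)%N.
  have [->|R0] := eqVneq R 0; first by rewrite size_poly0.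
  have : (size (R * T)%R <= h.*2.+1)%N.
    rewrite -defR (leq_trans (size_polyD _ _)) // size_polyN size_polyXn geq_max.
    apply/andP; split; last by lia.
    have [->|K0] := eqVneq K 0.
      by rewrite expr0n; case: (h) => [|?]; rewrite ?size_poly0 ?size_poly1.
    move: (size_poly_exp_leq K h) sK; move: (size K) (size (K ^+ h)%R) => ? ?; nia.
  rewrite size_mul // sT; move: (size R) => sR; lia.
have two_h : 2%:R * h%:R = -1 :> {poly F}.
  apply/eqP; rewrite -subr_eq0 opprK -natrM mul2n natr1.
  by rewrite -polyC_natr char.
(* [P = K ^+ h] satisfies [P' K = h K' P], and [2 h = -1]. *)
have defP' : (1 + D%:P * E%:P - 2%:R * E%:P * 'X) * ('X^h + T * R)
  = K * ('X^(h.-1) - 'X^h * R - 2%:R * T * R^`()).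
  have dK : K^`() = 1 + D%:P * E%:P - 2%:R * E%:P * 'X.
    by rewrite /K !derivE; ring.
  have := congr1 (fun p => 2%:R * (deriv p * K)) defP.
  rewrite deriv_exp derivD derivXn derivM /T derivB derivXn derivC subr0 -/T dK /=.
  rewrite -[_ *+ h]mulr_natl -[_ *+ h]mulr_natl -[_ *+ h.+1]mulr_natl -natr1 -defP.
  have eK : K ^+ h = K * K ^+ h.-1 by rewrite -exprS prednK.
  rewrite eK; move: (K ^+ h.-1) (1 + _ - _) => Kh dK' e.
  transitivity (- (2%:R * h%:R) * K * Kh * dK'); first by rewrite two_h; ring.
  transitivity (K * (- (2%:R * h%:R) * ('X^(h.-1) + 'X^h * R)
                     - 2%:R * 'X^h * R - 2%:R * T * R^`())).
    refine (@eq_of_subr_eq {poly F} _ _ _ _ (esym e) _); ring.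
  by rewrite two_h; ring.
have dvd1 : T %| 'X^(h.-1) * ('X * R * K - (E%:P * 'X ^+ 2 - D%:P)).
  apply/dvdpP; exists (- (1 + D%:P * E%:P - 2%:R * E%:P * 'X) * R - 2%:R * K * R^`()).
  have := defP'; rewrite -[in 'X^h](prednK h_gt0) exprS.
  rewrite /K => e.
  refine (@eq_of_subr_eq {poly F} _ _ _ _ e _); ring.
have cop : coprimep T 'X^(h.-1).
  apply: coprimep_expr; rewrite coprimepX rootE !hornerE /= expr0n /= sub0r oppr_eq0.
  exact: oner_neq0.
rewrite (Gauss_dvdpr _ cop) in dvd1.
have /dvdpP[S defS] := dvd1.
(* ['X * R * K] has degree at most [h + 2] and [T] has degree [h + 1], so [S] is at most linear. *)
have sS : (size S <= 2)%N.
  have [->|S0] := eqVneq S 0; first by rewrite size_poly0.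
  have : (size (S * T)%R <= h.+3)%N.
    rewrite -defS (leq_trans (size_polyD _ _)) // size_polyN geq_max.
    apply/andP; split.
      rewrite (leq_trans (size_polyMleq _ _)) //.
      have : (size ('X * R)%R <= h.+1)%N.
        by rewrite (leq_trans (size_polyMleq _ _)) // size_polyX add2n ltnS.
      by move: (size _) sK (size _) => ? ? ? ?; lia.
    rewrite (leq_trans (size_polyD _ _)) // size_polyN geq_max size_polyC.
    rewrite (leq_trans (size_polyMleq _ _)) ?size_polyC ?size_polyXn; by case: (_ != 0).
  by rewrite size_mul // sT; move: (size S) => ?; lia.
have [s1 [s0 eS]] : exists s1 s0 : F, S = s1%:P * 'X + s0%:P.
  exists S`_1, S`_0; apply/polyP => -[|[|i]]; rewrite !coefE ?addr0 ?mulr0 ?mulr1 ?add0r //=.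
  by rewrite nth_default // (leq_trans sS).
rewrite eS in defS.
have s0E : s0 = - D.
  have := congr1 (fun p => p.[0]) defS; rewrite /T !hornerE /= expr0n /= => e.
  by refine (@eq_of_subr_eq F _ _ _ _ e _); ring.
have RK : R * K = s1%:P * 'X^(h.+1) - D%:P * 'X^h + E%:P * 'X - s1%:P.
  apply: (mulfI (negbT (polyX_eq0 F))).
  rewrite mulrA; refine (@eq_of_subr_eq {poly F} _ _ _ _ defS _).
  by rewrite s0E /T exprS polyCN; ring.
have s1E : s1 = (- D) ^+ h.+1.
  have := congr1 (fun p => p.[0]) RK; have := congr1 (fun p => p.[0]) defP.
  rewrite /K /T !hornerE /= !expr0n /= gtn_eqF // !subr0 !mulr1 mulr0n => e1 e2.
  rewrite exprS e1; refine (@eq_of_subr_eq F _ _ _ _ e2 _); ring.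
by rewrite RK s1E.
Qed.

(** [D] is a root of [K], so the explicit formula for [R * K] vanishes there. For odd [h] this value
    is already contradictory; for even [h] it is identically zero, and the derivative at [D]
    decides. *)
Lemma norm1_translates (F : fieldType) (h : nat) (g D E : F) :
    (0 < h)%N -> h.*2.+1%:R = 0 :> F -> h.+1.-primitive_root g -> D != 0 ->
    D * E = D ^+ h.+1.*2 ->
    (forall z, z ^+ h.+1 = 1 -> ((z - D) * (1 - E * z)) ^+ h = z ^+ h) ->
  ~~ odd h /\ D ^+ h.+1 = -1.
Proof.
move=> h_gt0 char gP D0 DE hyp.
have [R [defP defR]] := cubic_remainder _ _ _ _ _ h_gt0 char gP D0 hyp.
(* Otherwise [z = D] would be allowed in [hyp], giving [0 = D ^+ h]. *)
have Dn1 : D ^+ h.+1 != 1.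
  apply/eqP=> /hyp/eqP; rewrite subrr mul0r expr0n gtn_eqF // eq_sym.
  by rewrite expf_eq0 (negPf D0) andbF.
set a := (- D) ^+ h.+1 in defR.
have a0 : a != 0 by rewrite expf_neq0 // oppr_eq0.
have aE : a = (-1) ^+ h.+1 * D ^+ h.+1 by exact: exprNn.
have DEa : D * E = a ^+ 2 by rewrite DE aE exprMn sqrr_sign mul1r -exprM muln2.
have e1 : a * D ^+ h.+1 - D ^+ h.+1 + D * E - a = 0.
  have := congr1 (fun p => p.[D]) defR; rewrite !hornerE /= => e.
  apply/esym; refine (@eq_of_subr_eq F _ _ _ _ e _); rewrite exprS; ring.
have two0 : 2%:R != 0 :> F.
  apply/eqP=> two0; have := char; rewrite -natr1 -mul2n natrM two0 mul0r add0r.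
  exact/eqP/oner_neq0.
have [odd_h|even_h] := boolP (odd h).
  have aD : a = D ^+ h.+1 by rewrite aE -signr_odd /= odd_h mul1r.
  have /eqP : 2%:R * (a * (a - 1)) = 0 by rewrite -e1 DEa -aD; ring.
  by rewrite mulf_eq0 (negPf two0) mulf_eq0 (negPf a0) subr_eq0 aD (negPf Dn1).
split=> //.
have aD : D ^+ h.+1 = - a by rewrite aE -signr_odd /= (negPf even_h) mulN1r opprK.
set K : {poly F} := ('X - D%:P) * (1 - E%:P * 'X).
have eK : K ^+ h.+1 = 'X^h * K
    + ('X^(h.+1) - 1) * (a%:P * 'X^(h.+1) - D%:P * 'X^h + E%:P * 'X - a%:P).
  by rewrite exprSr defP mulrDl -mulrA defR.
have KD : K.[D] = 0 by rewrite /K !hornerE /= subrr mul0r.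
have dKD : K^`().[D] = 1 - E * D by rewrite /K !derivE !hornerE /=; ring.
clearbody K.
have two_h : 2%:R * h%:R = -1 :> F.
  by apply/eqP; rewrite -subr_eq0 opprK -natrM mul2n natr1 char.
have dKn : ((K ^+ h.+1)^`()).[D] = 0.
  by rewrite deriv_exp hornerMn hornerM horner_exp KD expr0n gtn_eqF // mulr0 mul0rn.
have dXK : (('X^h * K)^`()).[D] = D ^+ h * (1 - E * D).
  by rewrite derivM hornerD !hornerM KD dKD hornerXn mulr0 add0r.
have /eqP : a * (1 - a) * (1 + a) = 0.
  (* The factor [2 D] allows [h] to be eliminated by [2 h = -1] and all powers of [D] to be
     expressed through [D ^+ h.+1 = - a]. *)
  have := congr1 (fun p : {poly F} => 2%:R * D * (p^`()).[D]) eK.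
  rewrite dKn mulr0 derivD hornerD dXK !derivE !(hornerE, hornerMn) /=.
  rewrite -[_ *+ h]mulr_natl -[_ *+ h.+1]mulr_natl -natr1.
  have -> : D ^+ h.+1 = D * D ^+ h by rewrite exprS.
  have -> : D ^+ h = D * D ^+ h.-1 by rewrite -exprS prednK.
  move: aD; rewrite -[in LHS](prednK h_gt0) !exprS; move: (D ^+ h.-1) => C aD' e.
  have {}e : 0 = 2%:R * (D * (D * C)) * (1 - D * E)
     + (2%:R * h%:R + 2%:R) * (D * (D * C))
         * (a * (D * (D * C)) - (D * (D * C)) + D * E - a)
     + (D * (D * C) - 1) * (a * (2%:R * h%:R + 2%:R) * (D * (D * C))
         - 2%:R * h%:R * (D * (D * C)) + 2%:R * (D * E)).
    apply: etrans e _; ring.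
  rewrite aD' two_h DEa in e.
  by apply/eqP; rewrite -oppr_eq0; apply/eqP/esym; apply: etrans e _; ring.
rewrite !mulf_eq0 (negPf a0) subr_eq0 addr_eq0 /= => /orP[]/eqP e.
  by rewrite aD -e.
by case/eqP: Dn1; rewrite aD -e.
Qed.

(** * The equivalence *)

(** As [r + 1 = 2 (h + 1)], the [r]-th power inverts both [z] and [D], whence
    [(z - D)^r = - (z - D) / (z D)]. This gives the powers [2 h] and [r + 1] of [z - D], and the
    result reduces to [- (z D)^-(h + 1) = 1]. *)
Lemma expr_translate1 (F : fieldType) (r h : nat) (z D : F) :
    [pchar F].-nat r -> r = h.*2.+1 -> ~~ odd h -> -1 != 1 :> F ->
    z ^+ h.+1 = 1 -> D ^+ h.+1 = -1 ->
  (z - D) ^+ (h * r.+1) = 1.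
Proof.
move=> char_r rE even_h N11 z1 D1.
have unit0 (x : F) : x ^+ h.+1 != 0 -> x != 0 by rewrite expf_eq0.
have z0 : z != 0 by rewrite unit0 // z1 oner_neq0.
have D0 : D != 0 by rewrite unit0 // D1 oppr_eq0 oner_neq0.
have zD : z - D != 0.
  by rewrite subr_eq0; apply: contraNneq N11 => zD; rewrite -D1 -zD z1.
have r1E : r.+1 = (h.+1 * 2)%N by rewrite rE; lia.
have zr : z ^+ r = z^-1 by apply: (mulfI z0); rewrite -exprS r1E exprM z1 expr1n divff.
have Dr : D ^+ r = D^-1 by apply: (mulfI D0); rewrite -exprS r1E exprM D1 sqrrN expr1n divff.
have zDr : (z - D) ^+ r = - (z - D) / (z * D).
  by rewrite exprDn_pchar // exprNn_pchar // zr Dr; field; rewrite z0 D0.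
have zDh : (z - D) ^+ h.*2 = - (z * D)^-1.
  by apply: (mulfI zD); rewrite -exprS -rE zDr; field; rewrite z0 D0.
rewrite mulnC exprM exprS zDr.
have -> : (z - D) * (- (z - D) / (z * D)) = - 1 * ((z - D) ^+ 2 * (z * D)^-1) by field; rewrite z0 D0.
rewrite exprMn exprMn -exprM mul2n zDh -signr_odd (negPf even_h) mul1r.
by rewrite exprVn mulNr -invfM -exprS exprMn z1 D1 mul1r invrN1 opprK.
Qed.

(** [w] generates the nonzero elements of the subfield of order [q], and [w ^+ s.-1] has order [M].
    Bezout for [k] and [m] makes every power of it an [(r - 1)]-th power in the subfield. *)
Lemma subfield_roots_powers (F : finFieldType) (p m k M : nat) :
    (1 < p)%N -> #|F| = ((p ^ m) ^ 2)%N -> (0 < k)%N -> (0 < m)%N ->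
    (p ^ m).-1 = ((p ^ gcdn k m).-1 * M)%N ->
  exists2 g : F, M.-primitive_root g &
    forall j, exists v, [/\ v != 0, v ^+ (p ^ m) = v & v ^+ (p ^ k).-1 = g ^+ j].
Proof.
move=> p_gt1 cardF k_gt0 m_gt0 ME; have [g0 g0P] := finField_prim_root F.
set q := (p ^ m)%N in cardF ME *; set r := (p ^ k)%N; set s := (p ^ _)%N in ME.
have gt1_exp i : (0 < i)%N -> (1 < p ^ i)%N by move=> ?; rewrite -{1}(exp1n i) ltn_exp2r.
have q_gt1 : (1 < q)%N by apply: gt1_exp.
have s_gt1 : (1 < s)%N by apply: gt1_exp; rewrite gcdn_gt0 k_gt0.
have r_gt1 : (1 < r)%N by apply: gt1_exp.
have cardE : #|F|.-1 = (q.+1 * s.-1 * M)%N by rewrite cardF -mulnA -ME; lia.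
have M_gt0 : (0 < M)%N by case: (posnP M) ME => // ->; rewrite muln0; lia.
set w := g0 ^+ q.+1.
have w0 : w != 0 by rewrite expf_neq0 // (prim_root_eq0 g0P) cardF; lia.
have wq : w ^+ q = w.
  by rewrite -[in LHS](prednK (ltnW q_gt1)) exprS -exprM ME mulnA -cardE (prim_expr_order g0P) mulr1.
exists (w ^+ s.-1).
  have := dvdn_prim_root g0P (_ : M %| _)%N; rewrite cardE => H.
  by have := H (dvdn_mull _ (dvdnn M)); rewrite mulnK // /w -exprM.
move=> j; case: (egcdnP m k_gt0) => u v' uv _.
pose T := (\sum_(i < u) r ^ i)%N.
have TE : (r ^ u).-1 = (r.-1 * T)%N by rewrite predn_exp.
set x := w ^+ j; have x0 : x != 0 by rewrite expf_neq0.
have xq : x ^+ q = x by rewrite /x exprAC wq.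
(* [(r - 1) T = r^u - 1], and [u k = v' m + gcdn k m] gives [x^(r^u) = x^s], since [x] is fixed by
   the [q]-th power. *)
exists (x ^+ T); split; [exact: expf_neq0 | by rewrite exprAC xq |].
rewrite [RHS]exprAC -/x -exprM mulnC -TE; apply: (mulfI x0).
have ru : (r ^ u).-1.+1 = (r ^ u)%N by rewrite prednK // expn_gt0 (ltnW r_gt1).
rewrite -!exprS ru (prednK (ltnW s_gt1)).
have xqi i : x ^+ (q ^ i) = x by elim: i => [|i IHi] //; rewrite expnS exprM xq.
by rewrite /r -expnM [(k * u)%N]mulnC uv expnD [(v' * m)%N]mulnC expnM exprM xqi.
Qed.

Lemma eq1_mod4_half (r h : nat) : r = h.*2.+1 -> (r = 1 %[mod 4])%N <-> ~~ odd h.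
Proof.
move=> ->.
have -> : (h.*2.+1 = 4 * h./2 + (odd h).*2.+1)%N by rewrite -{1}(odd_double_half h); lia.
by rewrite mulnC modnMDl; case: (odd h); split.
Qed.

Theorem theorem2p4 (F : finFieldType) (p m k : nat)
  (hp : prime p) (hodd : odd p) (hcard : #|F| = ((p ^ m) ^ 2)%N)
  (hk0 : (0 < k)%N) (hkm : (k < m)%N) (b c : F)
  (hbc : normN (p ^ m)%N b != normN (p ^ m)%N c) :
  planar (fmap (p ^ m)%N (p ^ k)%N b c) <->
  [/\ (p ^ k = 1 %[mod 4])%N, m = (2 * k)%N &
      normN (p ^ m)%N (b - c ^+ (p ^ m)%N) ^+ ((p ^ k + 1) %/ 2)%N
      = - (normN (p ^ m)%N b - normN (p ^ m)%N c) ^+ (p ^ k + 1)%N].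
Proof.
have p_gt1 := prime_gt1 hp; have m_gt0 : (0 < m)%N by apply: leq_trans hkm.
have charp : p \in [pchar F].
  by apply: (@card_finPcharP _ _ (m * 2)); rewrite // hcard expnM.
have char_pow i : [pchar F].-nat (p ^ i)%N by rewrite pnatX pnatE // charp.
have gt1_exp i : (0 < i)%N -> (1 < p ^ i)%N.
  by move=> i_gt0; rewrite -(exp1n i) ltn_exp2r.
have odd_exp i : odd (p ^ i) by rewrite oddX hodd orbT.
have halfE i : (p ^ i = ((p ^ i)./2).*2.+1)%N.
  by rewrite -[LHS]odd_double_half odd_exp.
have half_gt0 i : (0 < i)%N -> (0 < (p ^ i)./2)%N.
  by move/gt1_exp; rewrite [X in (_ < X)%N]halfE; lia.
rewrite planar_fmap_powersP // ?gt1_exp //.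
set n := normN _ b - normN _ c; set N := normN _ (b - _); set D := N / n ^+ 2.
have n0 : n != 0 by rewrite subr_eq0.
have D0 : D != 0.
  rewrite mulf_neq0 ?invr_eq0 ?expf_neq0 //; apply: contra_neq n0 => /eqP.
  rewrite subr_eq0 => /eqP bE; rewrite /n bE /normN !exprS -!exprM mulnn -hcard expf_card.
  by rewrite mulrC subrr.
set r := (p ^ k)%N; set h := r./2; have rE : r = h.*2.+1 := halfE k.
have DN : N ^+ ((r + 1) %/ 2) = - n ^+ (r + 1) <-> D ^+ h.+1 = -1.
  have -> : ((r + 1) %/ 2 = h.+1)%N by rewrite rE; lia.
  have -> : (r + 1 = 2 * h.+1)%N by rewrite rE; lia.
  have nh0 : (n ^+ 2) ^+ h.+1 != 0 by rewrite !expf_neq0.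
  rewrite expr_div_n exprM; split => [->|]; first by rewrite mulNr divff.
  by move/(canRL (divfK nh0)) => ->; rewrite mulN1r.
have mod4 := eq1_mod4_half _ _ rE.
apply: (@iff_trans _ [/\ ~~ odd h, m = (2 * k)%N & D ^+ h.+1 = -1]); last first.
  by split=> -[/mod4 ? ? /DN ?].
have N11 : -1 != 1 :> F.
  apply: contraTneq hodd => N11; have : (p %| 2)%N.
    by rewrite (dvdn_pcharf charp) -[2%:R]/(1 + 1) -{1}N11 addNr.
  by rewrite dvdn_prime2 // => /eqP ->.
split=> [hyp | [even_h mE D1] v v0 vq]; last first.
  have qE : (p ^ m = r * r)%N by rewrite mE mul2n -addnn expnD.
  have -> : ((p ^ m)./2 = h * r.+1)%N by rewrite qE rE; lia.
  apply: expr_translate1 => //; first exact: char_pow.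
  rewrite -!exprM; apply: (mulfI v0); rewrite -exprS mulr1 -[RHS]vq qE.
  by congr (_ ^+ _); rewrite rE; lia.
pose e := gcdn k m; pose s := (p ^ e)%N; pose l := s./2.
have sE : s = l.*2.+1 := halfE e.
have e_gt0 : (0 < e)%N by rewrite gcdn_gt0 hk0.
have [d mE] : exists d, m = (d * e)%N by apply/dvdnP/dvdn_gcdr.
pose M := (\sum_(i < d) s ^ i)%N.
have ME : (p ^ m).-1 = (s.-1 * M)%N by rewrite mE mulnC expnM predn_exp.
have qE : ((p ^ m)./2 = l * M)%N by move: ME; rewrite [X in X.-1]halfE sE; lia.
have [g gP powers] := subfield_roots_powers _ _ _ _ _ p_gt1 hcard hk0 m_gt0 ME.
have {}hyp j : ((g ^+ j) ^+ 2 - D) ^+ (l * M) = 1.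
  by have [v [v0 vq <-]] := powers j; rewrite -qE hyp.
(* [d = 1] would make [m = e] a divisor of [k < m]. *)
have d_gt1 : (1 < d)%N.
  rewrite ltnNge; apply/negP => d_le1; have := dvdn_leq hk0 (dvdn_gcdl k m : (e %| k)%N).
  by move: hkm; rewrite mE; case: (d) d_le1 => [|[|?]] //; lia.
have [d_gt2 | d_le2] := ltnP 2 d.
  have [M4 M4E] : exists M4, M = (1 + s + s * s * (1 + s * M4))%N.
    exists (\sum_(i < d - 3) s ^ i)%N.
    have sd : (s ^ d = s * s * s * s ^ (d - 3))%N by rewrite -{1}(subnKC d_gt2) !expnS; lia.
    have := predn_exp s (d - 3); set M4 := (\sum_(i < d - 3) _)%N => M4E.
    have s1_gt0 : (0 < s.-1)%N by rewrite sE /= double_gt0 half_gt0.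
    have [s_gt0 sX_gt0] : (0 < s)%N /\ (0 < s ^ (d - 3))%N by rewrite expn_gt0 sE.
    apply/eqP; rewrite -(eqn_pmul2l s1_gt0) -predn_exp sd; apply/eqP/succn_inj.
    rewrite prednK ?muln_gt0 ?s_gt0 // -(prednK sX_gt0) M4E.
    by move: (s.-1) (prednK s_gt0) => u <-; lia.
  by case: (three_digits_contra _ _ _ _ _ _ _ (char_pow e) (half_gt0 e e_gt0) sE M4E gP D0).
have dE : d = 2 by lia.
have MsE : M = s.+1 by rewrite /M dE !big_ord_recl big_ord0 /= expn0 expn1 addn0.
have ke : k = e.
  have /dvdnP[i kE] : (e %| k)%N by apply: dvdn_gcdl.
  by move: hkm hk0; rewrite mE dE kE; case: (i) => [|[|?]]; lia.
have rs : r = s by rewrite /r /s -ke.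
(* [M = s + 1 = 2 (l + 1)], so the squares of the [M]-th roots of unity are the [(l + 1)]-th
   ones. *)
have g2P : l.+1.-primitive_root (g ^+ 2).
  have := exp_prim_root gP 2.
  have -> : (M %/ gcdn 2 M = l.+1)%N; last by [].
  have -> : M = (2 * l.+1)%N by rewrite MsE sE; lia.
  by rewrite gcdnMr mulKn.
have char_s : [pchar F].-nat s by apply: char_pow.
have [even_l D1] : ~~ odd l /\ D ^+ l.+1 = -1.
  apply: (norm1_translates _ _ _ _ (D ^+ s) (half_gt0 e e_gt0) _ g2P D0).
  - by rewrite -sE /s natrX pcharf0 // expr0n gtn_eqF.
  - by rewrite -exprS sE doubleS.
  move=> _ /(prim_rootP g2P)[j ->]. set z := _ ^+ j.
  have zs : z * z ^+ s = 1.
    by rewrite -exprS -MsE /z exprAC [(g ^+ 2) ^+ M]exprAC (prim_expr_order gP) !expr1n.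
  (* With [z^s = z^-1], the choice [E = D^s] turns [(z - D)(1 - E z)] into [z (z - D)^(s + 1)],
     whose [l]-th power is known from [hyp]. *)
  have -> : 1 - D ^+ s * z = z * (z - D) ^+ s.
    by rewrite exprDn_pchar // exprNn_pchar // mulrDr zs; ring.
  rewrite mulrCA -exprS exprMn -exprM [(_ * l)%N]mulnC -MsE.
  by rewrite /z [(g ^+ 2) ^+ j]exprAC hyp mulr1.
by rewrite /h rs mE dE {1}ke.
Qed.
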